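(* Let $1\le p<\infty$, $\alpha>0$, $r_0>0$ and $\tau\ge1$. Let $E\subset X$ be bounded Lebesgue measurable subsets of $\mathbf{R}^n$, equipped with the measure $d\mu(x)=w(x)\,dx$, where $0<w\in L^t(X)$ for some $t\ge1$. Then the embedding $$P^{\alpha,p}_{\tau,E}(X,\mu)\cap L^1(X,\mu)\hookrightarrow L^1(E,\mu)$$ is compact for all $\alpha\ge n(1-1/p)/t$. In particular, for the exponents $p=2$ and $\alpha=1$ (and $n=2$), this holds for any weight $0<w\in L^1_{\rm loc}(\mathbf{R}^2)$.
   Context: $X$ carries the Euclidean metric, and $L^t(X)$ is with respect to Lebesgue measure; balls are open balls of the metric space $X$, come with a fixed centre and radius, and $\tau B(x,r)=B(x,\tau r)$; $u_{B,\mu}=\mu(B)^{-1}\int_Bu\,d\mu$. It is assumed that $\mu(E)>0$. $P^{\alpha,p}_{\tau,E}(X,\mu)$ consists of all $u\in L^1_{\rm loc}(X,\mu)$ (integrable on all balls) for which there is $0\le g\in L^p(X,\mu)$ such that $$\frac1{\mu(B)}\int_B|u-u_{B,\mu}|\,d\mu\le r^\alpha\Bigl(\frac1{\mu(\tau B)}\int_{\tau B}g^p\,d\mu\Bigr)^{1/p}\qquad( * )$$ for all balls $B=B(x,r)\subset X$ centred in $E$ and of radius at most $r_0$, where it is implicitly assumed that $0<\mu(B)<\infty$ for all such balls. Its seminorm is $\inf_g\|g\|_{L^p(X,\mu)}$ over all $g$ satisfying $( * )$; the intersection with $L^1(X,\mu)$ is normed by adding $\|u\|_{L^1(X,\mu)}$.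 Compact means that every bounded sequence has a subsequence converging in $L^1(E,\mu)$. *)

(* Defs.v *)
From HB Require Import structures.
From mathcomp Require Import all_boot all_order all_algebra.
From mathcomp Require Import all_classical all_reals all_analysis.
Import Order.TTheory GRing.Theory Num.Theory.
Import numFieldNormedType.Exports.

Set Implicit Arguments.
Unset Strict Implicit.
Unset Printing Implicit Defensive.

Local Open Scope classical_set_scope.
Local Open Scope ring_scope.

(* Lebesgue measure on R^n for n >= 1, R^n being ['rV[R]_m.+1] with n = m.+1:
   the outer measure is the infimum of the total volumes of countable covers by
   half-open boxes, and the Lebesgue measurable sets are its Caratheodory
   measurable sets. *)
Section lebesgue_outer_measure.
Context (R : realType) (m : nat).
Local Notation V := ('rV[R]_m.+1).

Definition box (c : V * V) : set V :=
  [set x | forall i, c.1 ord0 i < x ord0 i <= c.2 ord0 i].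

Definition box_volume (c : V * V) : R :=
  \prod_(i < m.+1) Num.max 0 (c.2 ord0 i - c.1 ord0 i).

Definition box_cover (A : set V) : set (nat -> V * V) :=
  [set F | A `<=` \bigcup_k box (F k)].

Definition lebesgue_outer (A : set V) : \bar R :=
  ereal_inf [set (\sum_(k <oo) (box_volume (F k))%:E)%E | F in box_cover A].

Lemma box_volume_ge0 c : 0 <= box_volume c.
Proof. by apply: prodr_ge0 => i _; rewrite le_max lexx. Qed.

Let volE_ge0 c : (0 <= (box_volume c)%:E)%E.
Proof. by rewrite lee_fin box_volume_ge0. Qed.

Lemma lebesgue_outer_ge0 A : (0 <= lebesgue_outer A)%E.
Proof. by apply: le_ereal_inf_tmp => _ [F _ <-]; apply: nneseries_ge0. Qed.

Lemma lebesgue_outer0 : lebesgue_outer set0 = 0%E.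
Proof.
apply/eqP; rewrite eq_le lebesgue_outer_ge0 andbT.
apply: ereal_inf_lbound; exists (fun=> (0, 0)); first by move=> x [].
apply: eseries0 => k _ _; congr EFin.
by rewrite /box_volume big_ord_recl /= subrr maxxx mul0r.
Qed.

Lemma le_lebesgue_outer : {homo lebesgue_outer : A B / A `<=` B >-> (A <= B)%E}.
Proof.
move=> A B AB; apply/ereal_inf_le_tmp => _ [F FB <-].
by exists F => //; apply: subset_trans AB FB.
Qed.

Lemma lebesgue_outer_sigma_subadditive : sigma_subadditive lebesgue_outer.
Proof.
move=> A; have [[i ioo]|] := pselect (exists i, lebesgue_outer (A i) = +oo%E).
  rewrite (eseries_pinfty _ _ ioo) ?leey// => n _.
  by rewrite -ltNye (lt_le_trans _ (lebesgue_outer_ge0 _)).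
rewrite -forallNE => Aoo.
apply/lee_addgt0Pr => e e0.
apply: le_trans (epsilon_trick _ _ (ltW e0)); last first.
  by move=> n; exact: lebesgue_outer_ge0.
pose P n (F : nat -> V * V) := box_cover (A n) F /\
  (\sum_(k <oo) (box_volume (F k))%:E <=
   lebesgue_outer (A n) + (e / (2 ^ n.+1)%:R)%:E)%E.
have [G PG] : {G : nat -> nat -> V * V & forall n, P n (G n)}.
  apply: (@choice _ _ P) => n; rewrite /P /lebesgue_outer.
  set S := (X in ereal_inf X).
  have en : 0 < e / (2 ^ n.+1)%:R by rewrite divr_gt0// ltr0n expn_gt0.
  have Sfin : ereal_inf S \is a fin_num.
    rewrite ge0_fin_numE; last exact: lebesgue_outer_ge0.
    by rewrite ltey; apply/eqP; exact: Aoo.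
  have [x [F FA <-] xS] := lb_ereal_inf_adherent en Sfin.
  by exists F; split => //; exact/ltW.
pose vol (i : nat * nat) := (box_volume (G i.1 i.2))%:E.
have vol_ge0 i : (0 <= vol i)%E by exact: volE_ge0.
apply: (@le_trans _ _ (\esum_(i in setT) vol i)%E).
  apply: ereal_inf_lbound => /=.
  have /card_esym/ppcard_eqP[f] := card_nat2.
  exists (fun k => G (f k).1 (f k).2).
    move=> t [i _ /(PG i).1 [j _ Bt]].
    by exists (f^-1%FUN (i, j)) => //=; rewrite invK ?inE.
  rewrite (reindex_esum [set: nat] setT f)//.
  by rewrite -nneseries_esumT.
rewrite (_ : esum _ _ = \sum_(i <oo) \sum_(j <oo) vol (i, j))%E; last first.
  rewrite nneseries_esumT; last by move=> i; exact: nneseries_ge0.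
  under [RHS]eq_esum do rewrite nneseries_esumT//.
  rewrite esum_esum//; congr esum.
  by apply/seteqP; split => // -[].
apply: lee_lim.
- by apply: is_cvg_nneseries => n _ _; exact: nneseries_ge0.
- apply: is_cvg_nneseries => n _ _; apply: adde_ge0.
    exact: lebesgue_outer_ge0.
  by rewrite lee_fin divr_ge0// ltW.
- by apply: nearW => n; apply: lee_sum => i _; exact: (PG i).2.
Qed.

HB.instance Definition _ := isOuterMeasure.Build R V lebesgue_outer
  lebesgue_outer0 lebesgue_outer_ge0 le_lebesgue_outer
  lebesgue_outer_sigma_subadditive.

End lebesgue_outer_measure.

Notation Rn R m := (caratheodory_type (@lebesgue_outer R m)).

Section lebesgueN.
Context (R : realType) (m : nat).

Definition lebesgueN : set (Rn R m) -> \bar R := @lebesgue_outer R m.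

HB.instance Definition _ := isMeasure.Build _ _ _ lebesgueN
  (@caratheodory_measure0 R _ (@lebesgue_outer R m))
  (@caratheodory_measure_ge0 R _ (@lebesgue_outer R m))
  (@caratheodory_measure_sigma_additive R _ (@lebesgue_outer R m)).

End lebesgueN.
Arguments lebesgueN : clear implicits.

Section metric.
Context (R : realType) (m : nat).

Definition edist (x y : 'rV[R]_m.+1) : R :=
  Num.sqrt (\sum_(i < m.+1) (x ord0 i - y ord0 i) ^+ 2).

Definition mball (X : set (Rn R m)) (x : Rn R m) (r : R) : set (Rn R m) :=
  [set y | X y /\ edist x y < r].

Definition ebounded (A : set (Rn R m)) : Prop :=
  exists M : R, forall x y, A x -> A y -> edist x y <= M.

End metric.

Section function_spaces.
Context (R : realType) (m : nat) (mu : {measure set (Rn R m) -> \bar R}).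
Implicit Types (X E D : set (Rn R m)) (u g : Rn R m -> R).

(* Functions are defined on all of R^n, but only their values on the set D
   matter. *)
Definition Lpnorm D (p : R) u : \bar R := 'N[mu]_(p%:E)[EFin \o (u \_ D)]%E.

Definition in_Lp D (p : R) u : Prop :=
  measurable_fun D u /\ (Lpnorm D p u < +oo)%E.

Definition in_L1loc X u : Prop :=
  forall x r, X x -> 0 < r -> mu.-integrable (mball X x r) (EFin \o u).

Definition avg D u : R := (fine (mu D))^-1 * \int[mu]_(x in D) u x.

Section poincare_space.
Variables (alpha p tau r0 : R) (E X : set (Rn R m)).

Definition poincare u g : Prop := forall x r, E x -> 0 < r -> r <= r0 ->
  avg (mball X x r) (fun y => `|u y - avg (mball X x r) u|)
  <= r `^ alpha * (avg (mball X x (tau * r)) (fun y => g y `^ p)) `^ p^-1.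

Definition admissible u : set (Rn R m -> R) :=
  [set g | [/\ forall x, X x -> 0 <= g x, in_Lp X p g & poincare u g]].

Definition in_P u : Prop := in_L1loc X u /\ exists g, admissible u g.

Definition P_seminorm u : \bar R :=
  ereal_inf [set Lpnorm X p g | g in admissible u].

Definition PL1_norm u : \bar R := (Lpnorm X 1 u + P_seminorm u)%E.

Definition compact_embedding : Prop :=
  forall u : nat -> Rn R m -> R,
    (forall k, in_P (u k) /\ in_Lp X 1 (u k)) ->
    (exists M : R, forall k, (PL1_norm (u k) <= M%:E)%E) ->
    exists (phi : nat -> nat) (v : Rn R m -> R),
      [/\ {homo phi : i j / (i < j)%N >-> (i < j)%N},
          in_Lp E 1 v &
          (fun k => Lpnorm E 1 (fun x => u (phi k) x - v x)) @ \oo --> 0%E].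

End poincare_space.
End function_spaces.

(* d mu = w dx on X; as a measure on R^n, mu does not charge the complement
   of X. *)
Definition weighted_measure (R : realType) (m : nat) (X : set (Rn R m))
    (w : Rn R m -> R) (mu : {measure set (Rn R m) -> \bar R}) : Prop :=
  forall A, measurable A ->
    mu A = (\int[lebesgueN R m]_(x in A `&` X) (w x)%:E)%E.

(* Main.v *)
(* At scale r, cover E by balls B_i of radius r centred in E, one for each cell
   of a grid of side r / n meeting E; the overlap of the balls tau B_i is then
   bounded by some N independent of r.  As s^(1/p) <= 1 + s, the Poincare
   inequality gives
     int_(B_i) |u - u_(B_i)| dmu <= r^alpha (mu(B_i) + int_(tau B_i) g^p dmu),
   and the sum over i is at most N r^alpha (mu(D) + int_X g^p dmu), where D is a
   fixed set of finite measure containing all small balls.  So on a bounded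
   sequence u is L^1-close, uniformly as r -> 0, to a function determined by the
   finitely many averages u_(B_i), which are bounded for fixed r.  Colouring the
   indices by the rounded averages, the pigeonhole principle and a diagonal
   argument yield an L^1-Cauchy subsequence. *)

From HB Require Import structures.
From mathcomp Require Import all_boot all_order all_algebra.
From mathcomp Require Import all_classical all_reals all_analysis.
From mathcomp Require Import measurable_realfun lra.
Require Import Defs.
Import Order.TTheory GRing.Theory Num.Theory.
Import numFieldNormedType.Exports.
Local Open Scope classical_set_scope.
Local Open Scope ring_scope.
Set Implicit Arguments.
Unset Strict Implicit.
Unset Printing Implicit Defensive.

(** * Pigeonhole, diagonal extraction and finite colourings *)

Lemma infinite_monochromatic (F : finType) (h : nat -> F) (I : set nat) :
  infinite_set I -> exists c, infinite_set (I `&` [set k | h k = c]).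
Proof.
move=> Ioo; apply/not_existsP => /= Ifin; apply: Ioo.
have -> : I = \bigcup_(c in [set: F]) (I `&` [set k | h k = c]).
  apply/seteqP; split=> [k Ik|k [c _ []]//]; by exists (h k).
apply: bigcup_finite; first exact: finite_finset.
by move=> c _; apply: contrapT => /Ifin.
Qed.

(** The pigeonhole principle gives a decreasing chain of infinite sets [S n] on which [d] is at most
    [eps n]; as [phi n] is taken in [S n], all its later values lie there too. *)
Lemma diagonal_subsequence (R : realType) (d : nat -> nat -> R)
    (eps : nat -> R) :
  (forall n, exists (F : finType) (h : nat -> F),
    forall i j, h i = h j -> d i j <= eps n) ->
  exists phi : nat -> nat,
    {homo phi : i j / (i < j)%N >-> (i < j)%N} /\
    forall n i j, (n <= i)%N -> (n <= j)%N -> d (phi i) (phi j) <= eps n.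
Proof.
move=> hd.
have /choice[J JP] : forall nI : nat * set nat, exists J : set nat,
    infinite_set nI.2 -> [/\ infinite_set J, J `<=` nI.2 &
      forall i j, J i -> J j -> d i j <= eps nI.1].
  move=> [n I] /=; have [F [h hP]] := hd n.
  have [/(infinite_monochromatic h)[c cP]|Ifin] := pselect (infinite_set I).
    exists (I `&` [set k | h k = c]) => _; split => // i j [_ /= hi] [_ /= hj].
    by apply: hP; rewrite hi hj.
  (* For a finite set the implication is vacuous; this case only makes [J] total. *)
  by exists I.
pose fix S n := if n is k.+1 then J (k.+1, S k) else J (0%N, setT).
have Soo n : infinite_set (S n).
  elim: n => [|n ih] /=; first by case: (JP (0%N, setT)) => //=; exact: infinite_nat.
  by case: (JP (n.+1, S n)).
have Sd n i j : S n i -> S n j -> d i j <= eps n.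
  case: n => [|n] /=; first by case: (JP (0%N, setT)) => [|_ _]; [exact: infinite_nat|exact].
  by case: (JP (n.+1, S n)) => [|_ _]; [exact: Soo|exact].
have SS n k : (n <= k)%N -> S k `<=` S n.
  elim: k => [|k ih]; first by rewrite leqn0 => /eqP->.
  rewrite leq_eqVlt => /predU1P[->//|/ih]; apply: subset_trans.
  by case: (JP (k.+1, S k)) => //; exact: Soo.
have /choice[f fP] : forall nx : nat * nat, exists y, S nx.1 y /\ (nx.2 < y)%N.
  move=> [n x] /=; apply: contrapT => nS; apply: (Soo n).
  apply: (@sub_finite_set _ _ `I_x.+1); last exact: finite_II.
  move=> y Sy /=; rewrite ltnS leqNgt; apply/negP => xy; apply: nS.
  by exists y.
(* The first bound [0] is arbitrary; each later value is chosen in its [S n] beyond the previous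
   one. *)
pose fix phi n := if n is k.+1 then f (k.+1, phi k) else f (0%N, 0%N).
have phiS n : S n (phi n) 
  by case: n => [|n]; [case: (fP (0%N, 0%N))|case: (fP (n.+1, phi n))].
exists phi; split.
  apply: homo_ltn => [y x z|n]; first exact: ltn_trans.
  by case: (fP (n.+1, phi n)).
by move=> n i j ni nj; apply: Sd; apply: SS (phiS _).
Qed.

Lemma truncn_eq_dist (R : realType) (a b : R) : 0 <= a -> 0 <= b ->
  Num.truncn a = Num.truncn b -> `|a - b| < 1.
Proof.
move=> a0 b0 ab.
have /andP[] := truncn_itv a0; have /andP[] := truncn_itv b0.
rewrite ab -natr1 ltr_norml => *; lra.
Qed.

(** The colour of [k] is the vector of integer parts of [(c k i + C) / delta]. These quotients lie
    between [0] and [2 * C / delta], so finitely many colours suffice, and equal integer parts leave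
    a gap below [delta]. *)
Lemma bounded_family_coloring (R : realType) (T : Type) (I : finType)
    (c : T -> I -> R) (C delta : R) : 0 < delta ->
  (forall k i, `|c k i| <= C) ->
  exists (F : finType) (h : T -> F), forall k l, h k = h l ->
    forall i, `|c k i - c l i| <= delta.
Proof.
move=> d0 cC; pose K := Num.truncn (2 * C / delta).
exists {ffun I -> 'I_K.+1},
  (fun k => [ffun i => inord (Num.truncn ((c k i + C) / delta))]).
have cK k i : 0 <= (c k i + C) / delta /\
    (Num.truncn ((c k i + C) / delta) < K.+1)%N.
  have := cC k i; rewrite ler_norml => /andP[c1 c2]; split.
    by rewrite divr_ge0 ?(ltW d0)//; lra.
  by rewrite ltnS; apply: le_truncn; rewrite ler_pM2r ?invr_gt0//; lra.
move=> k l /ffunP kl i; have := kl i; rewrite !ffunE => /(congr1 val) /=.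
rewrite !inordK; [|exact: (cK _ _).2..].
move=> /(truncn_eq_dist (cK _ _).1 (cK _ _).1).
rewrite -mulrBl normrM [`|delta^-1|]gtr0_norm ?invr_gt0// ltr_pdivrMr// mul1r.
rewrite (_ : c k i + C - (c l i + C) = c k i - c l i); last by lra.
exact: ltW.
Qed.

(** * Caratheodory measurability of half-spaces, coordinates and balls *)

Section coordinates_measurable.
Context (R : realType) (m : nat).
Local Notation V := ('rV[R]_m.+1).

(* A half-space cuts a box into two boxes, with upper resp. lower corner
   truncated at [a]. *)
Definition box_low (i : 'I_m.+1) (a : R) (c : V * V) : V * V :=
  (c.1, \row_j (if j == i then Num.min (c.2 ord0 j) a else c.2 ord0 j)).

Definition box_high (i : 'I_m.+1) (a : R) (c : V * V) : V * V :=
  (\row_j (if j == i then Num.max (c.1 ord0 j) a else c.1 ord0 j), c.2).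

(** The truncations at [0] keep this true for empty intervals and for a cut [a] outside the
    interval. *)
Lemma interval_length_split (l h a : R) :
  Num.max 0 (Num.min h a - l) + Num.max 0 (h - Num.max l a) =
  Num.max 0 (h - l).
Proof.
case: (leP h a) => ha; case: (leP l a) => la; case: (leP 0 (h - l)) => hl;
  case: (leP 0 (a - l)) => al; case: (leP 0 (h - a)) => ah; rewrite ?subrr ?maxxx; lra.
Qed.

Lemma box_volume_split i a c :
  box_volume (box_low i a c) + box_volume (box_high i a c) = box_volume c.
Proof.
rewrite /box_volume /= (bigD1 i)//= [in X in _ + X](bigD1 i)//= [RHS](bigD1 i)//=.
rewrite !mxE eqxx.
rewrite (eq_bigr (fun j => Num.max 0 (c.2 ord0 j - c.1 ord0 j))); last first.
  by move=> j /negPf ji; rewrite mxE ji.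
rewrite [in X in _ + X](eq_bigr (fun j => Num.max 0 (c.2 ord0 j - c.1 ord0 j))); last first.
  by move=> j /negPf ji; rewrite mxE ji.
by rewrite -mulrDl interval_length_split.
Qed.

(** Cutting each box of a cover of [A] yields covers of the two parts of [A] with the same total
    volume, which is the nontrivial half of Caratheodory's criterion. Half-open boxes are cut into
    half-open boxes. *)
Lemma halfspace_measurable (i : 'I_m.+1) (a : R) :
  measurable ([set x | x ord0 i <= a] : set (Rn R m)).
Proof.
apply: le_caratheodory_measurable => A.
apply: le_ereal_inf_tmp => _ [F FA <-].
have vol0 (G : nat -> V * V) : forall k, (0 <= (box_volume (G k))%:E)%E.
  by move=> k; rewrite lee_fin box_volume_ge0.
under eq_eseriesr do rewrite -(box_volume_split i a) EFinD.
rewrite nneseriesD//; [|by move=> *; exact: (vol0 (box_low i a \o F))|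
  by move=> *; exact: (vol0 (box_high i a \o F))].
apply: leeD; apply: ereal_inf_lbound.
- exists (box_low i a \o F) => // x [/FA[k _ Fk] xa]; exists k => // j /=.
  have /andP[F1 F2] := Fk j; rewrite F1 mxE; case: eqP => [ji|//].
  by rewrite le_min F2 ji.
- exists (box_high i a \o F) => // x [/FA[k _ Fk] /negP xa]; exists k => // j /=.
  have /andP[F1 F2] := Fk j; rewrite F2 mxE; case: eqP => [ji|]; last by rewrite F1.
  by rewrite gt_max F1 ji ltNge xa.
Qed.

Lemma coord_measurable (i : 'I_m.+1) :
  measurable_fun setT ((fun x : Rn R m => x ord0 i) : Rn R m -> R).
Proof.
apply: (measurability _ (RGenOInfty.measurableE R)) => _ [_ [a ->] <-].
rewrite setTI [X in measurable X](_ : _ = ~` [set x : Rn R m | x ord0 i <= a]).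
  exact/measurableC/halfspace_measurable.
by apply/seteqP; split=> x /=; rewrite in_itv /= andbT ltNge => /negP.
Qed.

Lemma mball_measurable (X : set (Rn R m)) (x : Rn R m) (r : R) :
  measurable X -> measurable (mball X x r).
Proof.
move=> mX; rewrite (_ : mball X x r =
  X `&` (edist x : Rn R m -> R) @^-1` `]-oo, r[%classic); last first.
  by apply/seteqP; split=> y /=; rewrite /mball /= in_itv.
apply: measurableI => //; rewrite -[X in measurable X]setTI.
have : measurable_fun setT (edist x : Rn R m -> R).
  apply: (measurableT_comp (continuous_measurable_fun (@sqrt_continuous R))).
  apply: measurable_sum => i; apply: measurable_funX.
  by apply: measurable_funB => //; exact: coord_measurable.
by apply.
Qed.

End coordinates_measurable.

(** * Grid nets whose dilated balls have bounded overlap *)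

Section grid.
Context (R : realType) (m : nat).
Local Notation V := ('rV[R]_m.+1).

Lemma coord_le_edist (x y : V) i : `|x ord0 i - y ord0 i| <= edist x y.
Proof.
rewrite -sqrtr_sqr ler_sqrt; last by apply: sumr_ge0 => j _; exact: sqr_ge0.
by rewrite (bigD1 i)//= lerDl; apply: sumr_ge0 => j _; exact: sqr_ge0.
Qed.

(** The crude factor [m.+1], in place of its square root, comes from [n <= n ^ 2]; with it, a grid
    cell of side [r / m.+1] lies in the ball of radius [r] about any of its points. *)
Lemma edist_lt (x y : V) s : (forall i, `|x ord0 i - y ord0 i| < s) ->
  edist x y < m.+1%:R * s.
Proof.
move=> xys; have s0 : 0 < s by exact: le_lt_trans (xys ord0).
have ms0 : 0 < m.+1%:R * s by rewrite mulr_gt0.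
rewrite -[ltRHS]gtr0_norm// -sqrtr_sqr ltr_sqrt ?exprn_gt0//.
apply: (@lt_le_trans _ _ (\sum_(i < m.+1) s ^+ 2)).
  apply: ltr_sum => [|i _]; first by apply/hasP; exists ord0; rewrite ?mem_index_enum.
  by rewrite -real_normK ?num_real// ltr_pXn2r// nnegrE ltW.
rewrite sumr_const card_ord exprMn -[leLHS]mulr_natl ler_wpM2r ?sqr_ge0//.
by rewrite -natrX ler_nat expnS leq_pmulr.
Qed.

Lemma truncn_dist (a b : R) (n : nat) : 0 <= a -> 0 <= b ->
  `|a - b| < n%:R -> (Num.truncn a <= Num.truncn b + n)%N.
Proof.
move=> a0 b0; rewrite ltr_norml => /andP[_ ab].
have /andP[_] := truncn_itv b0; rewrite -natr1 => bb.
rewrite -ltnS -(ltr_nat R) -natr1 natrD.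
have /andP[aa _] := truncn_itv a0; lra.
Qed.

Lemma eq_modn_near (a b n : nat) : (a <= b + n)%N -> (b <= a + n)%N ->
  a = b %[mod n.+1] -> a = b.
Proof.
wlog ab : a b / (a <= b)%N.
  by move=> H an bn e; case/orP: (leq_total a b) => h; [exact: H|exact/esym/H].
move=> _ ban /esym/eqP; rewrite eqn_mod_dvd// => /dvdn_leq.
have [/eqP|ab0 /(_ isT)] := posnP (b - a)%N; last by rewrite ltnNge leq_subLR ban.
by rewrite subn_eq0 => ba _; apply/eqP; rewrite eqn_leq ab.
Qed.

(* One point of [E] is chosen in each cell of side [r / (m + 1)] of a grid;
   cells whose points are close to a common [y] are told apart by their
   indices modulo a number independent of [r]. *)
Lemma grid_net (tau : R) : exists N : nat,
  forall (E : set V) (M r : R), (forall x y, E x -> E y -> edist x y <= M) ->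
  0 < r -> exists (I : finType) (x : I -> V),
  [/\ forall i, E (x i),
      forall y, E y -> exists i, forall j,
        `|x i ord0 j - y ord0 j| < r / m.+1%:R &
      forall y, (#|[set i | (edist (x i) y < tau * r)%R]%SET| <= N)%N].
Proof.
(* Two points within [tau * r] of [y] differ in each coordinate by less than [2 * tau * m.+1] cell
   sides; [n] exceeds this number, and the overlap bound counts the vectors of residues modulo
   [n.+1]. *)
pose n := (Num.truncn (2 * tau * m.+1%:R)).+1.
exists #|{ffun 'I_m.+1 -> 'I_n.+1}| => E M r EM r0.
have [[x0 Ex0]|E0] := pselect (E !=set0); last first.
  exists void, (of_void _).
  split=> [[]|y Ey|y]; first by exfalso; apply: E0; exists y.
  by rewrite (leq_trans (max_card _))// card_void.
pose s := r / m.+1%:R; have s0 : 0 < s by rewrite divr_gt0.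
(* Coordinates relative to [x0] in units of the cell side; adding [M] makes them nonnegative on
   [E]. *)
pose a (y : V) j := (y ord0 j - x0 ord0 j + M) / s.
pose K := (Num.truncn (2 * M / s)).+1.
have aE y j : E y -> 0 <= a y j <= 2 * M / s.
  move=> Ey; have := le_trans (coord_le_edist y x0 j) (EM _ _ Ey Ex0).
  rewrite ler_norml => /andP[? ?]; rewrite /a ler_pM2r ?invr_gt0// divr_ge0 ?(ltW s0)//=; lra.
pose cell (y : V) : {ffun 'I_m.+1 -> 'I_K} := [ffun j => inord (Num.truncn (a y j))].
have cellE y j : E y -> cell y j = Num.truncn (a y j) :> nat.
  by move=> /aE => /(_ j)/andP[_ ya]; rewrite ffunE inordK// ltnS le_truncn.
(* Only cells that meet [E] become indices, so that every centre can be taken in [E]. *)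
pose P c := `[< exists y, E y /\ cell y = c >].
have /choice[x xP] : forall c : {c | P c}, exists y, E y /\ cell y = val c.
  by move=> [c Pc]; exact/asboolP.
have asub y z j : a y j - a z j = (y ord0 j - z ord0 j) / s.
  by rewrite /a -mulrBl; congr (_ * _); lra.
have norms : `|s^-1| = s^-1 by rewrite gtr0_norm ?invr_gt0.
exists {c | P c}, x; split=> [c|y Ey|y]; first by case: (xP c).
  have Py : P (cell y) by apply/asboolP; exists y.
  exists (exist (fun c => P c) _ Py) => j.
  have [Ex xy] := xP (exist (fun c => P c) _ Py).
  have := congr1 (fun c : {ffun 'I_m.+1 -> 'I_K} => nat_of_ord (c j)) xy.
  rewrite /= !cellE// => /truncn_eq_dist.
  have /andP[-> _] := aE _ j Ex; have /andP[-> _] := aE _ j Ey => /(_ isT isT).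
  by rewrite asub normrM norms ltr_pdivrMr// mul1r.
pose res (c : {c | P c}) : {ffun 'I_m.+1 -> 'I_n.+1} :=
  [ffun j => inord (val c j %% n.+1)].
(* [res] is injective on the indices close to [y]: their cell numbers differ by at most [n], so
   residues modulo [n.+1] separate them. *)
rewrite -(@card_in_imset _ _ res) ?max_card// => c d.
rewrite !inE => cy dy /ffunP cd; apply/val_inj/ffunP => j; apply/val_inj => /=.
have [[Ec <-] [Ed <-]] := (xP c, xP d).
have near (c1 c2 : {c | P c}) : edist (x c1) y < tau * r ->
    edist (x c2) y < tau * r ->
    (Num.truncn (a (x c1) j) <= Num.truncn (a (x c2) j) + n)%N.
  move=> h1 h2; have [[E1 _] [E2 _]] := (xP c1, xP c2).
  apply: truncn_dist; [by case/andP: (aE _ j E1)|by case/andP: (aE _ j E2)|].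
  rewrite asub normrM norms; apply: (@lt_le_trans _ _ (2 * tau * m.+1%:R)).
    rewrite ltr_pdivrMr// [ltRHS](_ : _ = 2 * (tau * r)); last first.
      by rewrite -!mulrA [_ * s]mulrC divfK ?pnatr_eq0.
    have := le_lt_trans (coord_le_edist _ _ j) h1.
    have := le_lt_trans (coord_le_edist _ _ j) h2.
    rewrite !ltr_norml => /andP[? ?] /andP[? ?]; apply/andP; split; lra.
  exact/ltW/truncnS_gt.
apply: (@eq_modn_near _ _ n); rewrite ?cellE//; [exact: near|exact: near|].
have := congr1 val (cd j); rewrite !ffunE /= !inordK ?ltn_pmod//.
by rewrite -(xP c).2 -(xP d).2 !cellE.
Qed.

End grid.

(** * Completeness of L^1 along fast Cauchy sequences *)

Section L1_completeness.
Context d (T : measurableType d) (R : realType).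
Variables (mu : {measure set T -> \bar R}) (D : set T).
Hypothesis mD : measurable D.

(** Riesz-Fischer argument: the sum [G] of the increments is integrable, hence finite almost
    everywhere; where it is finite the sequence converges, and [|f 0| + G] dominates it. *)
Lemma L1_fast_cauchy_cvg (f : nat -> T -> R) :
  (forall n, mu.-integrable D (EFin \o f n)) ->
  (forall n, (\int[mu]_(x in D) `|f n.+1 x - f n x|%:E <=
    (1 / (2 ^ (n + 1))%:R)%:E)%E) ->
  exists v : T -> R, mu.-integrable D (EFin \o v) /\
    (fun n => \int[mu]_(x in D) `|f n x - v x|%:E)%E @ \oo --> 0%E.
Proof.
move=> fi fC.
have mf n : measurable_fun D (f n).
  exact/measurable_EFinP/measurable_int/(fi n).
pose g n x := (`|f n.+1 x - f n x|%:E)%E.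
have g0 n x : (0 <= g n x)%E by rewrite lee_fin.
have mg n : measurable_fun D (g n).
  by apply/measurable_EFinP/measurableT_comp => //; exact: measurable_funB.
pose G x := (\sum_(n <oo) g n x)%E.
have G0 x : (0 <= G x)%E by exact: nneseries_ge0.
have mG : measurable_fun D G by exact: ge0_emeasurable_sum.
have iG : mu.-integrable D G.
  apply/integrableP; split => //.
  under eq_integral do rewrite gee0_abs//.
  rewrite integral_nneseries//.
  apply: (@le_lt_trans _ _ (\sum_(n <oo) (1 / (2 ^ (n + 1))%:R)%:E)%E).
    by apply: lee_nneseries => n _; [move=> _; exact: integral_ge0|exact: fC].
  have /cvg_lim := @cvg_geometric_eseries_half R 1 0.
  rewrite /eseries /= => -> //; exact: ltry.
(* The upper limit is measurable on all of [D]; where it is infinite, [fine] gives [0]. *)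
pose v x := fine (limn_esup (fun n => (f n x)%:E)).
have mv : measurable_fun D v.
  apply: (measurableT_comp (fine_measurable _)) => //.
  by apply: measurable_fun_limn_esup => n; exact/measurable_EFinP.
have sumg x n : (`|f n x|%:E <= `|f 0%N x|%:E + G x)%E.
  apply: (@le_trans _ _ (`|f 0%N x|%:E + \sum_(0 <= k < n) g k x)%E); last first.
    by rewrite leeD2l// nneseries_lim_ge.
  elim: n => [|n ih]; first by rewrite big_geq// adde0.
  rewrite big_nat_recr//= addeA; apply: (@le_trans _ _ (`|f n x|%:E + g n x)%E).
    by rewrite -EFinD lee_fin -[X in `|X| <= _](subrK (f n x)) addrC ler_normD.
  by rewrite leeD2r.
have cvgf x : G x \is a fin_num -> (fun n => (f n x)%:E) @ \oo --> (v x)%:E.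
  move=> Gfin; have /cvg_ex[l fl] : cvgn (fun n => f n x).
    have : cvgn [normed series (telescope (f ^~ x))].
      apply: nondecreasing_is_cvgn.
        by apply: nondecreasing_series => n _ _; exact: normr_ge0.
      exists (fine (G x)) => _ [n _ <-]; rewrite -lee_fin fineK//= seriesEnat.
      by rewrite /= -sumEFin; exact: nneseries_lim_ge.
    move=> /normed_cvg; rewrite telescopeK => cf.
    rewrite (_ : (fun n => f n x) = (fun n => f n x - f 0%N x) \+ cst (f 0%N x)).
      by apply: is_cvgD => //; exact: is_cvg_cst.
    by apply/funext => n /=; rewrite subrK.
  have fle : (fun n => (f n x)%:E) @ \oo --> l%:E by apply: cvg_EFin => //; exact: nearW.
  by rewrite /v (cvg_limn_einf_sup fle).
have aecvg : {ae mu, forall x, D x -> (fun n => (f n x)%:E) @ \oo --> (v x)%:E}.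
  by apply: filterS (integrable_ae mD iG) => x Gx /Gx; exact: cvgf.
have := @dominated_convergence _ _ _ mu D mD (fun n => EFin \o f n) (EFin \o v)
  (fun x => `|f 0%N x|%:E + G x)%E.
case=> //.
- by move=> n; exact/measurable_EFinP.
- exact/measurable_EFinP.
- by apply: integrableD => //; exact/(integrable_norm (fi 0%N)).
- by apply: aeW => x n _; exact: sumg.
by move=> iv cv _; exists v.
Qed.

End L1_completeness.

(** * Integrals and measures over finite covers with bounded overlap *)

Section overlapping_covers.
Context d (T : measurableType d) (R : realType).
Variables (mu : {measure set T -> \bar R}) (D : set T) (I : finType).
Variables (B : I -> set T) (f : T -> R).
Hypotheses (mD : measurable D) (mB : forall i, measurable (B i)).
Hypothesis BD : forall i, B i `<=` D.
Hypotheses (f0 : forall x, D x -> 0 <= f x) (mf : measurable_fun D f).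

Let restr0 i x : D x -> (0 <= ((f \_ (B i)) x)%:E)%E.
Proof. by move=> Dx; rewrite lee_fin patchE; case: ifP => // _; exact: f0. Qed.

Let mrestr i : measurable_fun D (EFin \o (f \_ (B i))).
Proof.
by apply/measurable_EFinP/measurable_restrict => //; exact: measurable_funS mf.
Qed.

(** The integrand on the right is [f] times the number of sets [B i] containing the point. The cover
    estimates then become pointwise: this multiplicity is at least [1] on a covered set and at most
    [N] under bounded overlap. *)
Lemma sum_integral_restrict :
  (\sum_i \int[mu]_(x in B i) (f x)%:E =
   \int[mu]_(x in D) (\sum_i (f \_ (B i)) x)%:E)%E.
Proof.
under [RHS]eq_integral do rewrite -sumEFin.
rewrite ge0_integral_sum//.
apply: eq_bigr => i _; rewrite -[in LHS](setIidr (@BD i)) integral_mkcondr.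
by apply: eq_integral => x _; rewrite !patchE; case: ifP.
Qed.

Lemma integral_cover_le (E : set T) : measurable E -> E `<=` D ->
  E `<=` \bigcup_i B i ->
  (\int[mu]_(x in E) (f x)%:E <= \sum_i \int[mu]_(x in B i) (f x)%:E)%E.
Proof.
move=> mE ED EB; rewrite sum_integral_restrict.
have sum0 x : D x -> (0 <= (\sum_i (f \_ (B i)) x)%:E)%E.
  by move=> Dx; rewrite -sumEFin; apply: sume_ge0 => i _; exact: restr0.
have msum : measurable_fun D (fun x => (\sum_i (f \_ (B i)) x)%:E).
  by apply/measurable_EFinP/measurable_sum => i; exact/measurable_EFinP.
apply: le_trans (ge0_subset_integral _ mE mD msum sum0 ED).
apply: ge0_le_integral => //.
- by move=> x Ex; rewrite lee_fin f0//; exact: ED.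
- by apply/measurable_EFinP; exact: measurable_funS mf.
- exact: measurable_funS msum.
- move=> x Ex; have [i _ Bx] := EB _ Ex; rewrite lee_fin (bigD1 i)//= patchE.
  rewrite mem_set// lerDl; apply: sumr_ge0 => j _.
  by rewrite -lee_fin; apply: restr0; exact: ED.
Qed.

Lemma sum_integral_overlap_le (N : nat) :
  (forall y, (#|[set i | y \in B i]%SET| <= N)%N) ->
  (\sum_i \int[mu]_(x in B i) (f x)%:E <=
   N%:R%:E * \int[mu]_(x in D) (f x)%:E)%E.
Proof.
move=> BN; rewrite sum_integral_restrict -ge0_integralZl_EFin//; last exact/measurable_EFinP.
apply: ge0_le_integral => //.
- by move=> x Dx; rewrite -sumEFin; apply: sume_ge0 => i _; exact: restr0.
- by apply/measurable_EFinP/measurable_sum => i; exact/measurable_EFinP.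
- by apply/measurable_EFinP/measurable_funM => //; exact/measurable_EFinP.
move=> x Dx; rewrite -EFinM lee_fin; under eq_bigr do rewrite patchE.
rewrite -big_mkcond sumr_const -[leLHS]mulr_natl ler_wpM2r ?f0// ler_nat.
by rewrite (leq_trans _ (BN x))// subset_leq_card//; apply/fintype.subsetP => i; rewrite inE.
Qed.

End overlapping_covers.

Section measure_of_covers.
Context d (T : measurableType d) (R : realType).
Variables (mu : {measure set T -> \bar R}) (D : set T) (I : finType).
Variables (B : I -> set T).
Hypotheses (mD : measurable D) (mB : forall i, measurable (B i)).

Let integral1 (A : set T) :
  measurable A -> (\int[mu]_(x in A) (1 : R)%:E = mu A)%E.
Proof. by move=> mA; rewrite integral_cst// mul1e. Qed.

Lemma measure_cover_le : D `<=` \bigcup_i B i -> (mu D <= \sum_i mu (B i))%E.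
Proof.
move=> DB; rewrite -integral1//.
under eq_bigr do rewrite -integral1//.
exact: (@integral_cover_le _ _ _ _ setT).
Qed.

Lemma sum_measure_overlap_le (N : nat) : (forall i, B i `<=` D) ->
  (forall y, (#|[set i | y \in B i]%SET| <= N)%N) ->
  (\sum_i mu (B i) <= N%:R%:E * mu D)%E.
Proof.
move=> BD BN; rewrite -integral1//.
under eq_bigr do rewrite -integral1//.
exact: sum_integral_overlap_le.
Qed.

End measure_of_covers.

Section integral_of_distances.
Context d (T : measurableType d) (R : realType).
Variables (mu : {measure set T -> \bar R}) (D : set T).
Hypothesis mD : measurable D.

Lemma measurable_dist (f g : T -> R) : measurable_fun D f ->
  measurable_fun D g -> measurable_fun D (fun x => `|f x - g x|).
Proof. by move=> mf mg; apply: measurableT_comp => //; exact: measurable_funB. Qed.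

(** Triangle inequality through the constants [a] and [b], later the averages of two members of the
    sequence over one ball. *)
Lemma integral_dist_le (f g : T -> R) (a b delta : R) :
  measurable_fun D f -> measurable_fun D g -> `|a - b| <= delta ->
  (\int[mu]_(x in D) `|f x - g x|%:E <=
   \int[mu]_(x in D) `|f x - a|%:E + \int[mu]_(x in D) `|g x - b|%:E +
   delta%:E * mu D)%E.
Proof.
move=> mf mg abd.
have mfa : measurable_fun D (fun x => `|f x - a|%:E).
  by apply/measurable_EFinP/measurable_dist.
have mgb : measurable_fun D (fun x => `|g x - b|%:E).
  by apply/measurable_EFinP/measurable_dist.
have mfg : measurable_fun D (fun x => `|f x - g x|%:E).
  by apply/measurable_EFinP/measurable_dist.
rewrite -integral_cst// -ge0_integralD// -ge0_integralD//; last 3 first.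
- by move=> y _; rewrite adde_ge0.
- exact: emeasurable_funD.
- by move=> y _; rewrite lee_fin (le_trans _ abd).
apply: ge0_le_integral => //.
  by apply: emeasurable_funD => //; exact: emeasurable_funD.
move=> y _; rewrite -!EFinD lee_fin.
rewrite [f y - g y](_ : _ = (f y - a) - (g y - b) + (a - b)); last by lra.
by rewrite (le_trans (ler_normD _ _))// lerD//; exact: ler_normB.
Qed.

End integral_of_distances.

(** The power is at most the larger of [1] and [a]. With [q = p^-1] this replaces the root in the
    Poincare inequality by a linear term, which can be summed over balls. *)
Lemma powR_le_1D (R : realType) (a q : R) : 0 <= a -> 0 <= q -> q <= 1 ->
  a `^ q <= 1 + a.
Proof.
move=> a0 q0 q1; have [a1|/ltW a1] := leP 1 a.
  by rewrite (le_trans (ler1_powR a1 q1))// lerDr.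
apply: (@le_trans _ _ (1 `^ q)); last by rewrite powR1 lerDl.
by rewrite ge0_ler_powR// nnegrE.
Qed.

(** * Norms as integrals *)

Section Lp_norms.
Context (R : realType) (m : nat) (mu : {measure set (Rn R m) -> \bar R}).

Lemma Lpnorm1E (D : set (Rn R m)) (u : Rn R m -> R) :
  Lpnorm mu D 1 u = (\int[mu]_(x in D) `|u x|%:E)%E.
Proof.
rewrite /Lpnorm Lnorm1 [RHS]integral_mkcond; apply: eq_integral => x _ /=.
by rewrite !patchE; case: ifP => //; rewrite normr0.
Qed.

Lemma in_Lp1_integrable (D : set (Rn R m)) (u : Rn R m -> R) :
  in_Lp mu D 1 u -> mu.-integrable D (EFin \o u).
Proof.
move=> [mu_ fu]; apply/integrableP; split; first exact/measurable_EFinP.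
by rewrite -Lpnorm1E.
Qed.

Lemma integral_powR_Lpnorm_le (D : set (Rn R m)) (g : Rn R m -> R) (p C : R) :
  0 < p -> (forall x, D x -> 0 <= g x) -> 0 <= C -> (Lpnorm mu D p g <= C%:E)%E ->
  (\int[mu]_(x in D) (g x `^ p)%:E <= (C `^ p)%:E)%E.
Proof.
move=> p0 g0 C0 gC; rewrite -poweR_EFin.
rewrite (_ : (\int[mu]_(x in D) _)%E = (Lpnorm mu D p g `^ p)%E).
  apply: gt0_ler_poweR gC; rewrite ?(ltW p0)// in_itv/= ?leey andbT ?lee_fin//.
  exact: Lnorm_ge0.
rewrite /Lpnorm poweR_Lnorm ?gt_eqF// [LHS]integral_mkcond.
apply: eq_integral => x _ /=; rewrite !patchE -poweR_EFin; case: ifPn => [|_].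
  by rewrite inE => /g0 gx; rewrite ger0_norm.
by rewrite normr0 powR0// gt_eqF.
Qed.

End Lp_norms.

(** * Averages and the Poincare inequality on one ball *)

Section poincare_estimates.
Context (R : realType) (m : nat) (mu : {measure set (Rn R m) -> \bar R}).
Variables (X : set (Rn R m)).
Hypothesis mX : measurable X.

Lemma mball_subset (x : Rn R m) r : mball X x r `<=` X.
Proof. by move=> y []. Qed.

Lemma le_mball (x : Rn R m) r s : r <= s -> mball X x r `<=` mball X x s.
Proof. by move=> rs y [Xy xy]; split => //; exact: lt_le_trans rs. Qed.

Lemma integrable_sub_cst (D : set (Rn R m)) (u : Rn R m -> R) (c : R) :
  measurable D -> (mu D < +oo)%E -> mu.-integrable D (EFin \o u) ->
  mu.-integrable D (EFin \o (fun x => `|u x - c|)).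
Proof.
move=> mD fD iu; apply: (@integrable_norm _ _ _ mu D (fun x => u x - c)).
rewrite (_ : EFin \o _ = (EFin \o u) \- cst c%:E)%E; last by apply/funext => x.
apply: integrableB => //; apply/integrableP; split => //.
by rewrite /= integral_cst// lte_mul_pinfty.
Qed.

(** Bounds the averages of an L^1-bounded sequence over a fixed ball. If [mu B] is [0] or infinite,
    both sides are [0]. *)
Lemma avg_le (B : set (Rn R m)) (u : Rn R m -> R) (M : R) :
  measurable B -> B `<=` X -> mu.-integrable X (EFin \o u) ->
  (\int[mu]_(x in X) `|u x|%:E <= M%:E)%E ->
  `|avg mu B u| <= M / fine (mu B).
Proof.
move=> mB BX iu uM; have iuB : mu.-integrable B (EFin \o u) by exact: integrableS iu.
have V0 : 0 <= (fine (mu B))^-1 by rewrite invr_ge0 fine_ge0.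
rewrite /avg normrM ger0_norm// mulrC ler_wpM2r//.
apply: le_trans (le_normr_Rintegral mB iuB) _; rewrite -lee_fin.
have inB : mu.-integrable B (EFin \o (fun x => `|u x|)) by exact: integrable_norm.
rewrite /Rintegral fineK; last exact: integrable_fin_num.
apply: le_trans uM; apply: ge0_subset_integral => //.
apply/measurable_EFinP/measurableT_comp => //.
exact/measurable_EFinP/(measurable_int mu).
Qed.

(** Multiply the inequality by [mu(B)], bound the root by [1 + s], and absorb the factor
    [mu(B) / mu(tau B) <= 1]. *)
Lemma poincare_ball_le (u g : Rn R m -> R) (x : Rn R m) (alpha p tau r : R) :
  1 <= p -> 1 <= tau -> 0 < r -> mu.-integrable X (EFin \o u) ->
  (forall y, X y -> 0 <= g y) -> measurable_fun X g ->
  (\int[mu]_(y in X) (g y `^ p)%:E < +oo)%E ->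
  (0 < mu (mball X x r) < +oo)%E ->
  avg mu (mball X x r) (fun y => `|u y - avg mu (mball X x r) u|)
    <= r `^ alpha * (avg mu (mball X x (tau * r)) (fun y => g y `^ p)) `^ p^-1 ->
  (\int[mu]_(y in mball X x r) `|u y - avg mu (mball X x r) u|%:E <=
   (r `^ alpha)%:E *
     (mu (mball X x r) + \int[mu]_(y in mball X x (tau * r)) (g y `^ p)%:E))%E.
Proof.
move=> p1 tau1 r0 iu g0 mg gp /andP[B0 Boo] poinc.
set B := mball X x r in B0 Boo poinc *.
set tB := mball X x (tau * r) in poinc *.
have mB : measurable B by exact: mball_measurable.
have mtB : measurable tB by exact: mball_measurable.
have BtB : B `<=` tB by apply: le_mball; rewrite ler_peMl// ltW.
have muBfin : mu B \is a fin_num by rewrite ge0_fin_numE.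
have b0 : 0 < fine (mu B) by rewrite fine_gt0// B0.
have igX : mu.-integrable X (EFin \o (fun y => g y `^ p)).
  apply/integrableP; split.
    apply/measurable_EFinP; exact: (measurableT_comp (measurable_powR p)).
  by under eq_integral do rewrite gee0_abs ?lee_fin ?powR_ge0//.
have igt : mu.-integrable tB (EFin \o (fun y => g y `^ p)).
  by apply: integrableS igX => //; exact: mball_subset.
have iuB : mu.-integrable B (EFin \o u).
  by apply: integrableS iu => //; exact: mball_subset.
have iB := integrable_sub_cst (avg mu B u) mB Boo iuB.
rewrite -(fineK (integrable_fin_num mB iB)) -(fineK (integrable_fin_num mtB igt)).
rewrite -(fineK muBfin) -EFinD -EFinM lee_fin.
set J := fine (\int[mu]_(y in tB) _)%E.
have J0 : 0 <= J by apply: Rintegral_ge0 => y _; exact: powR_ge0.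
rewrite -[leLHS](mulVKf (lt0r_neq0 b0)).
apply: le_trans (ler_wpM2l (ltW b0) poinc) _.
rewrite mulrCA ler_wpM2l ?powR_ge0//.
have A0 : 0 <= avg mu tB (fun y => g y `^ p).
  by apply: mulr_ge0 J0; rewrite invr_ge0 fine_ge0.
have q0 : 0 <= p^-1 by rewrite invr_ge0 (le_trans _ p1).
have q1 : p^-1 <= 1 by rewrite invf_le1// (lt_le_trans _ p1).
apply: le_trans (ler_wpM2l (ltW b0) (powR_le_1D A0 q0 q1)) _.
rewrite mulrDr mulr1 lerD2l mulrA ler_piMl//.
(* [tB] may have infinite measure; then [fine] gives [0], so the quotient is [0] and the bound still
   holds. *)
have [tBfin|] := boolP (mu tB \is a fin_num); last first.
  by rewrite ge0_fin_numE// -leNgt leye_eq => /eqP -> /=; rewrite invr0 mulr0.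
have ttb : fine (mu B) <= fine (mu tB) by rewrite fine_le// le_measure ?inE.
by rewrite ler_pdivrMr ?mul1r// (lt_le_trans b0).
Qed.

End poincare_estimates.

(** * Choice of scale, total boundedness in L^1(E) and compactness *)

Lemma small_powR (R : realType) (alpha A e r1 : R) :
  0 < alpha -> 0 <= A -> 0 < e -> 0 < r1 ->
  exists r, [/\ 0 < r, r <= r1 & r `^ alpha * A <= e].
Proof.
move=> al0 A0 e0 r10; have A1 : 0 < A + 1 by rewrite ltr_pwDr.
have q0 : 0 < e / (A + 1) by rewrite divr_gt0.
(* Solves [q ^ alpha * (A + 1) = e]; the [+ 1] avoids division by [0] when [A = 0]. *)
pose q := (e / (A + 1)) `^ alpha^-1.
have qp : 0 < q by rewrite powR_gt0.
exists (Num.min r1 q); split; first by rewrite lt_min r10.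
  by rewrite ge_min lexx.
apply: (@le_trans _ _ (q `^ alpha * A)).
  rewrite ler_wpM2r// ge0_ler_powR ?nnegrE ?(ltW al0) ?(ltW qp)//.
    by rewrite le_min !ltW.
  by rewrite ge_min lexx orbT.
rewrite -powRrM mulVf ?gt_eqF// powRr1 ?(ltW q0)//.
by rewrite mulrAC ler_pdivrMr// ler_pM2l// lerDl.
Qed.

Section compactness.
Context (R : realType) (m : nat) (mu : {measure set (Rn R m) -> \bar R}).
Variables (X E : set (Rn R m)) (alpha p tau r0 : R).
Hypotheses (mX : measurable X) (mE : measurable E) (EX : E `<=` X).
Hypotheses (bE : ebounded E) (r0_gt0 : 0 < r0) (tau_ge1 : 1 <= tau).
Hypotheses (p_ge1 : 1 <= p) (alpha_gt0 : 0 < alpha).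
Hypothesis muB : forall x r, E x -> 0 < r -> r <= r0 ->
  (0 < mu (mball X x r) < +oo)%E.

(** Finite measure is given only for balls centred in [E] of radius at most [r0]; [D] is a finite
    union of such balls about a net of [E]. *)
Lemma finite_measure_neighborhood : exists (D : set (Rn R m)) (r1 : R),
  [/\ measurable D, (mu D < +oo)%E, 0 < r1, r1 <= r0 &
      forall x r, E x -> r <= r1 -> mball X x r `<=` D].
Proof.
have [M EM] := bE; have [N netN] := @grid_net R m 1.
have h0 : 0 < r0 / 2 by rewrite divr_gt0.
have [I [x [Ex xE _]]] := netN E M (r0 / 2) EM h0.
pose D := \bigcup_(i in [set: I]) mball X (x i) r0.
have mD : measurable D.
  by apply: fin_bigcup_measurable => // i _; exact: mball_measurable.
(* Some net point is within [s] of [y] in each coordinate, and [z] is within [s] of [y]; since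
   [m.+1 * (s + s) = r0], [z] is in the ball of radius [r0] about that net point. *)
pose s := r0 / 2 / m.+1%:R; have s0 : 0 < s by rewrite divr_gt0.
exists D, s; split => //.
- apply: le_lt_trans (measure_cover_le mu mD _ (@subset_refl _ D)) _.
    by move=> i; exact: mball_measurable.
  by rewrite lte_sum_pinfty// => i _; have /andP[] := muB (Ex i) r0_gt0 (lexx _).
- rewrite ler_pdivrMr//; apply: (@le_trans _ _ r0).
    by rewrite ler_pdivrMr// ler_peMr ?(ltW r0_gt0)// ler1n.
  by rewrite ler_peMr ?(ltW r0_gt0)// ler1n.
move=> y r Ey rs z [Xz yz]; have [i xi] := xE y Ey.
exists i => //; split => //; rewrite (_ : r0 = m.+1%:R * (s + s)); last first.
  by rewrite mulrDr [_ * s]mulrC divfK ?pnatr_eq0// -splitr.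
apply: edist_lt => j; rewrite -(subrKA (y ord0 j)).
apply: le_lt_trans (ler_normD _ _) _; rewrite ltrD//.
by rewrite (le_lt_trans (coord_le_edist _ _ _))// (lt_le_trans yz).
Qed.

Lemma sum_oscillation_le (I : finType) (x : I -> Rn R m) (r : R) (N : nat)
    (D : set (Rn R m)) (u g : Rn R m -> R) :
  0 < r -> r <= r0 -> (forall i, E (x i)) ->
  (forall y, (#|[set i | (edist (x i) y < tau * r)%R]%SET| <= N)%N) ->
  measurable D -> (forall i, mball X (x i) r `<=` D) ->
  mu.-integrable X (EFin \o u) -> admissible mu alpha p tau r0 E X u g ->
  (\int[mu]_(y in X) (g y `^ p)%:E < +oo)%E ->
  (\sum_i \int[mu]_(y in mball X (x i) r)
      `|u y - avg mu (mball X (x i) r) u|%:E <=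
   (r `^ alpha * N%:R)%:E *
     (mu D + \int[mu]_(y in X) (g y `^ p)%:E))%E.
Proof.
move=> rp rr0 Ex xN mD BD iu [g0 [mg _] poinc] gp.
apply: (@le_trans _ _ (\sum_i (r `^ alpha)%:E * (mu (mball X (x i) r) +
    \int[mu]_(y in mball X (x i) (tau * r)) (g y `^ p)%:E))%E).
  apply: lee_sum => i _; apply: poincare_ball_le => //; first exact: muB.
  exact: poinc.
rewrite -ge0_sume_distrr; last first.
  by move=> i _; rewrite adde_ge0// integral_ge0// => y _; rewrite lee_fin powR_ge0.
rewrite big_split /= EFinM -muleA lee_wpmul2l ?lee_fin ?powR_ge0//.
rewrite ge0_muleDr//; last first.
  by apply: integral_ge0 => y _; rewrite lee_fin powR_ge0.
(* Measures are summed inside [D], integrals inside [X]. As [1 <= tau], the balls themselves overlap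
   no more than the dilated ones. *)
apply: leeD.
  apply: sum_measure_overlap_le => // [i|y]; first exact: mball_measurable.
  apply: leq_trans (xN y); apply/subset_leq_card/fintype.subsetP => i.
  rewrite !inE => -[_ /lt_le_trans]; apply; by rewrite ler_peMl// ltW.
have mB i : measurable (mball X (x i) (tau * r)) by exact: mball_measurable.
have BX i : mball X (x i) (tau * r) `<=` X by exact: mball_subset.
have gp0 y : X y -> 0 <= g y `^ p by move=> _; exact: powR_ge0.
have mgp : measurable_fun X (fun y => g y `^ p).
  exact: (measurableT_comp (measurable_powR p)).
apply: (sum_integral_overlap_le mu mX mB BX gp0 mgp) => y.
apply: leq_trans (xN y); apply/subset_leq_card/fintype.subsetP => i.
by rewrite !inE => -[].
Qed.

(** Total boundedness, phrased as a finite colouring for the diagonal argument. First [r] is fixed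
    so that each function deviates from its averages by at most [e / 4] in total; then the averages
    are rounded to accuracy [delta]. *)
Lemma L1_totally_bounded (u g : nat -> Rn R m -> R) (M G : R) :
  0 <= G ->
  (forall k, mu.-integrable X (EFin \o u k)) ->
  (forall k, admissible mu alpha p tau r0 E X (u k) (g k)) ->
  (forall k, (\int[mu]_(x in X) `|u k x|%:E <= M%:E)%E) ->
  (forall k, (\int[mu]_(x in X) (g k x `^ p)%:E <= G%:E)%E) ->
  forall e, 0 < e -> exists (F : finType) (h : nat -> F), forall k l, h k = h l ->
    (\int[mu]_(x in E) `|u k x - u l x|%:E <= e%:E)%E.
Proof.
move=> G0 iu ug uM gG e e0.
have [D [r1 [mD Doo r10 r1r0 BD]]] := finite_measure_neighborhood.
have [K EK] := bE; have [N netN] := @grid_net R m tau.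
have Dfin : mu D \is a fin_num by rewrite ge0_fin_numE.
pose D0 := fine (mu D); have D00 : 0 <= D0 by exact: fine_ge0.
pose A := N%:R * (D0 + G).
have A0 : 0 <= A by rewrite mulr_ge0// addr_ge0.
have e4 : 0 < e / 4 by rewrite divr_gt0.
have [r [rp rr1 rA]] := small_powR alpha_gt0 A0 e4 r10.
have rr0 : r <= r0 by exact: le_trans r1r0.
have [I [x [Ex xE xN]]] := netN E K r EK rp.
pose B i := mball X (x i) r.
have mB i : measurable (B i) by exact: mball_measurable.
have BX i : B i `<=` X by exact: mball_subset.
have BD' i : B i `<=` D by exact: BD.
pose c k i := avg mu (B i) (u k).
pose C := \sum_i (M / fine (mu (B i))).
have M0 : 0 <= M.
  by rewrite -lee_fin (le_trans _ (uM 0%N))// integral_ge0.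
have cC k i : `|c k i| <= C.
  apply: le_trans (avg_le mX (mB i) (BX i) (iu k) (uM k)) _.
  rewrite /C (bigD1 i)//= lerDl sumr_ge0// => j _.
  by rewrite divr_ge0// fine_ge0.
(* The balls have total measure at most [N * D0], so the differences of averages contribute less
   than [e / 4]; the [+ 1] avoids division by [0]. *)
pose delta := e / 4 / (N%:R * D0 + 1).
have ND0 : 0 <= N%:R * D0 by rewrite mulr_ge0.
have delta0 : 0 < delta by rewrite divr_gt0// ltr_pwDr.
have [F [h hP]] := bounded_family_coloring delta0 cC.
exists F, h => k l /hP hkl.
have mu_ j : measurable_fun X (u j) by exact/measurable_EFinP/(measurable_int mu).
have muB_ j i : measurable_fun (B i) (u j) by exact: measurable_funS (mu_ j).
have osc j : (\sum_i \int[mu]_(y in B i) `|u j y - c j i|%:E <= (e / 4)%:E)%E.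
  have gj := le_lt_trans (gG j) (ltry _).
  have := sum_oscillation_le rp rr0 Ex xN mD BD' (iu j) (ug j) gj.
  move/le_trans; apply.
  apply: (@le_trans _ _ ((r `^ alpha * N%:R)%:E * (D0 + G)%:E)%E).
    rewrite lee_wpmul2l ?lee_fin ?mulr_ge0 ?powR_ge0//.
    by rewrite EFinD leeD// fineK.
  by rewrite -EFinM lee_fin -mulrA.
apply: (@le_trans _ _ (\sum_i \int[mu]_(y in B i) `|u k y - u l y|%:E)%E).
  have mkl : measurable_fun X (fun y => `|u k y - u l y|).
    exact: measurable_dist.
  have nn y : X y -> 0 <= `|u k y - u l y| by [].
  apply: (integral_cover_le mu mX mB BX nn mkl mE EX).
  move=> y Ey; have [i xy] := xE y Ey; exists i => //; split; first exact: EX.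
  rewrite (_ : r = m.+1%:R * (r / m.+1%:R)); first exact: edist_lt.
  by rewrite mulrC divfK ?pnatr_eq0.
apply: (@le_trans _ _ (\sum_i (\int[mu]_(y in B i) `|u k y - c k i|%:E +
    \int[mu]_(y in B i) `|u l y - c l i|%:E + delta%:E * mu (B i)))%E).
  apply: lee_sum => i _.
  by apply: integral_dist_le; [exact: mB|exact: muB_|exact: muB_|exact: hkl].
rewrite 2!big_split /= (_ : e = e / 4 + e / 4 + e / 2); last by lra.
rewrite !EFinD; apply: leeD; first by apply: leeD; exact: osc.
rewrite -ge0_sume_distrr//.
apply: (@le_trans _ _ (delta%:E * (N%:R * D0)%:E)%E).
  rewrite lee_wpmul2l ?lee_fin ?(ltW delta0)//.
  rewrite EFinM fineK//; apply: sum_measure_overlap_le => // y.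
  apply: leq_trans (xN y); apply/subset_leq_card/fintype.subsetP => i.
  rewrite !inE => -[_ /lt_le_trans]; apply; by rewrite ler_peMl// ltW.
rewrite -EFinM lee_fin /delta mulrAC ler_pdivrMr ?ltr_pwDr//.
apply: ler_pM; [exact: ltW e4|exact: ND0|lra|by rewrite lerDl].
Qed.

Lemma poincare_compact_embedding : compact_embedding mu alpha p tau r0 E X.
Proof.
move=> u uP [M uM].
have uL k : (Lpnorm mu X 1 (u k) <= M%:E)%E.
  apply: le_trans (uM k); rewrite leeDl//.
  by apply: le_ereal_inf_tmp => _ [g _ <-]; exact: Lnorm_ge0.
have M0 : 0 <= M by rewrite -lee_fin (le_trans _ (uL 0%N))// Lnorm_ge0.
have iu k : mu.-integrable X (EFin \o u k).
  by apply: in_Lp1_integrable; case: (uP k).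
(* The infimum need not be attained; [M + 1] leaves room for an admissible function above it. *)
have /choice[g gP] : forall k, exists g, admissible mu alpha p tau r0 E X (u k) g /\
    (Lpnorm mu X p g <= (M + 1)%:E)%E.
  move=> k; have : (P_seminorm mu alpha p tau r0 E X (u k) < (M + 1)%:E)%E.
    apply: (@le_lt_trans _ _ M%:E); last by rewrite lte_fin ltrDl.
    by apply: le_trans (uM k); rewrite leeDr// Lnorm_ge0.
  by move=> /ereal_inf_lt[_ [g gu <-] /ltW gM]; exists g.
have p0 : 0 < p by exact: lt_le_trans p_ge1.
have gM k : (\int[mu]_(x in X) (g k x `^ p)%:E <= ((M + 1) `^ p)%:E)%E.
  have [[g0 _ _] gk] := gP k.
  by apply: integral_powR_Lpnorm_le => //; rewrite addr_ge0.
have iuE k : mu.-integrable E (EFin \o u k) by exact: integrableS (iu k).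
have iE k l : mu.-integrable E (fun x => `|u k x - u l x|%:E).
  apply: (@integrable_norm _ _ _ mu E (fun x => u k x - u l x)).
  exact: (integrableB mE (iuE k) (iuE l)).
(* The tolerances are those required by [L1_fast_cauchy_cvg]; [fine] loses nothing, as these
   integrals are finite. *)
have [] := @diagonal_subsequence R
  (fun k l => fine (\int[mu]_(x in E) `|u k x - u l x|%:E)%E)
  (fun n => 1 / (2 ^ (n + 1))%:R).
  move=> n; have e0 : 0 < 1 / (2 ^ (n + 1))%:R :> R.
    by rewrite divr_gt0// ltr0n expn_gt0.
  have uL' k : (\int[mu]_(x in X) `|u k x|%:E <= M%:E)%E by rewrite -Lpnorm1E.
  have [F [h hP]] := L1_totally_bounded (powR_ge0 (M + 1) p) iu
    (fun k => (gP k).1) uL' gM e0.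
  exists F, h => k l /hP; rewrite -lee_fin fineK//; exact: integrable_fin_num.
move=> phi [phi_incr phiC].
have [n|v [iv cv]] := L1_fast_cauchy_cvg mE (fun n => iuE (phi n)).
  have := phiC n n.+1 n (leqnSn _) (leqnn _).
  by rewrite -lee_fin fineK//; exact: integrable_fin_num.
exists phi, v; split => //.
  split; first exact/measurable_EFinP/(measurable_int mu).
  by rewrite Lpnorm1E; case/integrableP : iv.
by under eq_fun do rewrite Lpnorm1E.
Qed.

End compactness.

(** * The embedding for weighted Lebesgue measure *)

Theorem proposition3p8 (R : realType) (r0 tau : R)
    (r0_gt0 : 0 < r0) (tau_ge1 : 1 <= tau) :
  (forall (m : nat) (p alpha t : R) (X E : set (Rn R m)) (w : Rn R m -> R)
      (mu : {measure set (Rn R m) -> \bar R}),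
    1 <= p -> 0 < alpha -> 1 <= t ->
    E `<=` X ->
    ebounded X -> measurable X -> ebounded E -> measurable E ->
    (forall x, X x -> 0 < w x) -> in_Lp (lebesgueN R m) X t w ->
    weighted_measure X w mu ->
    (0 < mu E)%E ->
    (forall x r, E x -> 0 < r -> r <= r0 ->
      (0 < mu (mball X x r) < +oo)%E) ->
    m.+1%:R * (1 - p^-1) / t <= alpha ->
    compact_embedding mu alpha p tau r0 E X)
  /\
  (forall (X E : set (Rn R 1)) (w : Rn R 1 -> R)
      (mu : {measure set (Rn R 1) -> \bar R}),
    E `<=` X ->
    ebounded X -> measurable X -> ebounded E -> measurable E ->
    (forall x, 0 < w x) -> in_L1loc (lebesgueN R 1) setT w ->
    weighted_measure X w mu ->
    (0 < mu E)%E ->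
    (forall x r, E x -> 0 < r -> r <= r0 ->
      (0 < mu (mball X x r) < +oo)%E) ->
    compact_embedding mu 1 2 tau r0 E X).
Proof.
split.
  move=> m p alpha t X E w mu p1 alpha0 _ EX _ mX bE mE _ _ _ _ muB _.
  exact: poincare_compact_embedding.
move=> X E w mu EX _ mX bE mE _ _ _ _ muB.
by apply: poincare_compact_embedding => //; rewrite ler1n.
Qed.
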